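(* Fix $\varepsilon>0$ and a polynomial $\sigma$. There exist constants $c>0$ and $d_0\in\mathbb{N}$, $d_0\ge 2$ (depending only on $\varepsilon$ and $\sigma$) such that the following holds. For each $d\in\mathbb{N}$ there exist formulations of nonempty polytopes $P_1,P_2\subseteq\mathbb{R}^d$, of size $f_1$ and $f_2$ respectively, such that, for every $\varepsilon$-approximation $P'\subseteq\mathbb{R}^d$ of $\operatorname{conv}(P_1\cup P_2)$, any formulation of $P'$ of size at most $\sigma(f_1+f_2)$ has $\Omega(d/\log d)$ additional variables, i.e. has at least $c\,d/\log d$ additional variables whenever $d\ge d_0$.
   Context: For a set $X$, $\operatorname{conv}(X)$ is its convex hull. Given a polytope $P\subseteq\mathbb{R}^d$, a polytope $Q\subseteq\mathbb{R}^{d+m}$ (with $m\ge 0$) is a linear extension of $P$ with $m$ additional variables if $P=\operatorname{proj}_x(Q):=\{x\in\mathbb{R}^d:\exists\,y\in\mathbb{R}^m\text{ such that }(x,y)\in Q\}$; the case $Q=P$ ($m=0$) is allowed. A formulation of $P$ is a (finite) system of linear inequalities describing a linear extension $Q$ of $P$; its size is the number of inequalities in the system, and its number of additional variables is $m$. Given $\varepsilon\ge 0$, a polytope $P'\subseteq\mathbb{R}^d$ is an $\varepsilon$-approximation of a nonempty polytope $P\subseteq\mathbb{R}^d$ if $P\subseteq P'$ and for all $c\in\mathbb{R}^d$ $$\max_{x\in P'}cx-\min_{x\in P'}cx\le(1+\varepsilon)\Big(\max_{x\in P}cx-\min_{x\in P}cx\Big).$$ *)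

(* Defs.v *)
From HB Require Import structures.
From mathcomp Require Import all_boot all_order all_algebra.
From mathcomp Require Import all_classical all_reals all_analysis.

Set Implicit Arguments.
Unset Strict Implicit.
Unset Printing Implicit Defensive.

Import Order.TTheory GRing.Theory Num.Theory.
Import numFieldNormedType.Exports.

Local Open Scope classical_set_scope.
Local Open Scope ring_scope.

Definition polyhedron (R : realType) (k n : nat)
    (A : 'M[R]_(k, n)) (b : 'cV[R]_k) : set 'cV[R]_n :=
  [set z | forall i, (A *m z) i 0 <= b i 0].

Definition is_polytope (R : realType) (n : nat) (X : set 'cV[R]_n) : Prop :=
  (exists k (A : 'M[R]_(k, n)) (b : 'cV[R]_k), X = polyhedron A b) /\
  bounded_set X.

Definition conv_hull (R : realType) (n : nat) (X : set 'cV[R]_n) : set 'cV[R]_n :=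
  smallest (@convex_set R 'cV[R]_n) X.

Definition proj_x (R : realType) (d m : nat) (Q : set 'cV[R]_(d + m)) :
    set 'cV[R]_d :=
  [set x | exists y : 'cV[R]_m, Q (col_mx x y)].

Definition linear_extension (R : realType) (d m : nat)
    (P : set 'cV[R]_d) (Q : set 'cV[R]_(d + m)) : Prop :=
  [/\ is_polytope P, is_polytope Q & P = proj_x Q].

(* The system [A z <= b] has size [k] and [m] additional variables. *)
Definition formulation (R : realType) (d m k : nat) (P : set 'cV[R]_d)
    (A : 'M[R]_(k, d + m)) (b : 'cV[R]_k) : Prop :=
  linear_extension P (polyhedron A b).

(* On a nonempty polytope the linear form [c] attains its supremum and its
   infimum, so this is the difference of its maximum and its minimum. *)
Definition width (R : realType) (n : nat) (c : 'rV[R]_n)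
    (X : set 'cV[R]_n) : R :=
  sup [set (c *m x) 0 0 | x in X] - inf [set (c *m x) 0 0 | x in X].

(* Meant for a nonempty polytope [P]. *)
Definition eps_approximation (R : realType) (n : nat) (eps : R)
    (P' P : set 'cV[R]_n) : Prop :=
  [/\ is_polytope P', P `<=` P' &
      forall c : 'rV[R]_n, width c P' <= (1 + eps) * width c P].

(* Main.v *)
Require Import Defs.
From HB Require Import structures.
From mathcomp Require Import all_boot all_order all_algebra.
From mathcomp Require Import all_classical all_reals all_analysis.
From mathcomp Require Import ring lra zify.

Set Implicit Arguments.
Unset Strict Implicit.
Unset Printing Implicit Defensive.

Import Order.TTheory GRing.Theory Num.Theory.
Import numFieldNormedType.Exports.

Local Open Scope classical_set_scope.
Local Open Scope ring_scope.

(** Take for [P1] the simplex with vertices 0 and the unit vectors, and for [P2]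
    its opposite: [d + 1] inequalities each, no additional variable.  The hull of
    their union is the cross-polytope.  Every [eps]-approximation [P'] of it
    contains the points [+-e_i] but none of the [2 ^ d] points [(mu / d) s],
    where [s] is a sign vector and [mu = 3 + 2 eps]: in the direction [s] the
    cross-polytope has width at most 2, while [P'] would have width at least
    [mu > 2 (1 + eps)] ([approximation_avoids]).

    One inequality cannot cut off many of these points.  If [v x <= beta] holds on
    [P'], then [|v_i| <= beta] because [+-e_i] lies in [P'], so cutting off
    [(mu / d) s] means that the sum of the [s_i v_i / beta], whose terms are in
    [[-1, 1]], exceeds [d / mu].  By an exponential moment bound this holds for at
    most a fraction [exp (- d / (8 mu ^ 2))] of the sign vectors
    ([few_aligned_signs]).  Hence [P'] needs exponentially many inequalities.

    A projection along [m] variables of a system of [k] inequalities has at most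
    [(k + 1) ^ (m + 1)] relevant inequalities.  Indeed the point [x] lies outside
    the projection when the system in the remaining [m] unknowns is infeasible.
    Farkas' lemma, proved here by Fourier-Motzkin elimination, then combines the
    inequalities with a nonnegative multiplier that is orthogonal to the columns
    of the eliminated variables.  A multiplier of minimal support is determined by
    its support up to scaling ([elementary_farkas]), and its support has at most
    [m + 1] elements ([card_supp_elementary]); so the inequality that it yields is
    determined by a set of at most [m + 1] rows.

    Together, [exp (d / (8 mu ^ 2)) <= (k + 1) ^ (m + 1)] ([many_inequalities]).
    When [k] is at most polynomial in [d], the right-hand side is at most
    [d ^ (K (m + 1))] for a constant [K], and taking logarithms gives
    [m + 1 >= 2 c d / ln d]. *)

(** * Farkas' lemma by Fourier-Motzkin elimination *)

(** Each inequality bounds [z] from above, from below, or not at all; the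
    hypotheses say that every lower bound is below every upper bound, so the
    tightest upper bound, or else the tightest lower bound, is a solution. *)
Lemma solve_one_unknown (F : realFieldType) (I : finType) (c r : I -> F) :
  (forall i, c i = 0 -> 0 <= r i) ->
  (forall i j, 0 < c i -> c j < 0 -> 0 <= c i * r j - c j * r i) ->
  exists z, forall i, c i * z <= r i.
Proof.
move=> r0 rpn; case: (pickP (fun i => 0 < c i)) => [i0 ci0|cle0].
  case: (@arg_minP _ _ _ i0 (fun i => 0 < c i) (fun i => r i / c i) ci0) => p cp pmin.
  exists (r p / c p) => i; case: (ltrgt0P (c i)) => ci.
  - by rewrite mulrC -ler_pdivlMr //; apply: pmin.
  - rewrite mulrA ler_pdivrMr //.
    by have := rpn _ _ cp ci; rewrite subr_ge0 (mulrC (r i)).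
  - by rewrite ci mul0r r0.
case: (pickP (fun i => c i < 0)) => [i0 ci0|cge0].
  case: (@arg_maxP _ _ _ i0 (fun i => c i < 0) (fun i => r i / c i) ci0) => q cq qmax.
  exists (r q / c q) => i; case: (ltrgt0P (c i)) => ci.
  - by have := cle0 i; rewrite ci.
  - by rewrite mulrC -ler_ndivrMr //; apply: qmax.
  - by rewrite ci mul0r r0.
exists 0 => i; rewrite mulr0 r0 //; apply/eqP.
by rewrite eq_le !leNgt; apply/andP; split; apply/negP => h;
  [have := cle0 i|have := cge0 i]; rewrite h.
Qed.

Section FourierMotzkin.
Variables (F : realFieldType) (I : finType) (c : I -> F).

(** Row [j] gives the coefficients of one combination in which the unknown with
    coefficients [c] vanishes: [inl p] keeps an inequality [p] that does not
    involve it, and [inr (p, n)] combines an upper bound [p] with a lower bound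
    [n].  The other indices give the zero combination, which makes the index type
    of the reduced system independent of [c]. *)
Definition eliminator (j : I + I * I) (i : I) : F :=
  match j with
  | inl p => (c p == 0)%:R * (i == p)%:R
  | inr (p, n) => ((0 < c p) && (c n < 0))%:R *
                  (c p * (i == n)%:R - c n * (i == p)%:R)
  end.

Lemma eliminator_ge0 j i : 0 <= eliminator j i.
Proof.
case: j => [p|[p n]] /=; first by rewrite mulr_ge0.
case: andP => [[cp cn]|_]; rewrite ?mul0r// mul1r subr_ge0.
by apply: (@le_trans _ _ 0); rewrite ?nmulr_rle0 ?pmulr_rge0.
Qed.

Lemma sum_eliminator j (r : I -> F) :
  \sum_i eliminator j i * r i =
  match j with
  | inl p => (c p == 0)%:R * r p
  | inr (p, n) => ((0 < c p) && (c n < 0))%:R * (c p * r n - c n * r p)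
  end.
Proof.
have delta p : \sum_i (i == p)%:R * r i = r p.
  rewrite (bigD1 p) //= eqxx mul1r big1 ?addr0// => i /negPf ->.
  by rewrite mul0r.
case: j => [p|[p n]] /=.
  by under eq_bigr do rewrite -mulrA; rewrite -mulr_sumr delta.
under eq_bigr do rewrite -mulrA mulrBl -!mulrA.
by rewrite -mulr_sumr sumrB -!mulr_sumr !delta.
Qed.

Lemma eliminator_cancels j : \sum_i eliminator j i * c i = 0.
Proof.
rewrite sum_eliminator; case: j => [p|[p n]].
  by case: eqP => [->|]; rewrite ?mulr0 ?mul0r.
by rewrite mulrC (mulrC (c p)) subrr mul0r.
Qed.

End FourierMotzkin.

(** Induction on the number of unknowns: the first one is eliminated.  A solution
    of the reduced system extends by [solve_one_unknown], and a multiplier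
    refuting the reduced system pulls back along [eliminator].  The rows range
    over an arbitrary finite type since elimination changes it. *)
Lemma farkas_fun (F : realFieldType) m (I : finType)
    (a : I -> 'I_m -> F) (w : I -> F) :
  (exists y : 'I_m -> F, forall i, \sum_l a i l * y l <= w i) \/
  (exists u : I -> F, [/\ forall i, 0 <= u i,
     forall l, \sum_i u i * a i l = 0 & \sum_i u i * w i < 0]).
Proof.
elim: m I a w => [|m IHm] I a w.
  case: (pickP (fun i => w i < 0)) => [i0 wi0|wge0].
    right; exists (fun i => (i == i0)%:R); split=> // [[]//|].
    rewrite (bigD1 i0) //= eqxx mul1r big1 ?addr0// => i /negPf ->.
    by rewrite mul0r.
  left; exists (fun=> 0) => i; rewrite big_ord0 leNgt.
  by have := wge0 i => /= ->.
pose c i := a i ord0; pose M := eliminator c.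
have [[y yP]|[u [u0 ua uw]]] := IHm _
  (fun j l => \sum_i M j i * a i (lift ord0 l)) (fun j => \sum_i M j i * w i).
  left; pose r i := w i - \sum_l a i (lift ord0 l) * y l.
  have Mr j : 0 <= \sum_i M j i * r i.
    rewrite /r; under eq_bigr do rewrite mulrBr mulr_sumr.
    rewrite sumrB exchange_big /= subr_ge0.
    under eq_bigr do (under eq_bigr do rewrite mulrA; rewrite -mulr_suml).
    exact: yP.
  have [z zP] : exists z, forall i, c i * z <= r i.
    apply: solve_one_unknown => [i ci|p n cp cn].
      by have := Mr (inl i); rewrite sum_eliminator ci eqxx mul1r.
    by have := Mr (inr (p, n)); rewrite sum_eliminator cp cn mul1r.
  exists (fun l => if unlift ord0 l is Some l' then y l' else z) => i.
  rewrite big_ord_recl unlift_none.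
  under eq_bigr do rewrite liftK.
  by rewrite -lerBrDr; apply: zP.
right; exists (fun i => \sum_j u j * M j i).
have swap (f : I -> F) :
    \sum_i (\sum_j u j * M j i) * f i = \sum_j u j * \sum_i M j i * f i.
  under eq_bigr do rewrite mulr_suml.
  rewrite exchange_big /=; apply: eq_bigr => j _; rewrite mulr_sumr.
  by apply: eq_bigr => i _; rewrite mulrA.
split=> [i|l|].
- by apply: sumr_ge0 => j _; rewrite mulr_ge0// eliminator_ge0.
- rewrite swap; have [l' ->|->] := unliftP ord0 l; first exact: ua.
  by apply: big1 => j _; rewrite eliminator_cancels mulr0.
- by rewrite swap.
Qed.

Section Certificates.
Variables (F : realFieldType) (k m : nat) (B : 'M[F]_(k, m)) (w : 'cV[F]_k).

Definition certificate (u : 'rV[F]_k) :=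
  [/\ forall i, 0 <= u 0 i, u *m B = 0 & (u *m w) 0 0 < 0].

Lemma farkas : ~ (exists y : 'cV[F]_m, forall i, (B *m y) i 0 <= w i 0) ->
  exists u, certificate u.
Proof.
move=> noy.
have [[y yP]|[u [u0 uB uw]]] := farkas_fun (fun i l => B i l) (fun i => w i 0).
  case: noy; exists (\col_l y l) => i; rewrite mxE.
  by under eq_bigr do rewrite mxE.
exists (\row_i u i); split=> [i||]; first by rewrite mxE.
  by apply/rowP => l; rewrite !mxE; under eq_bigr do rewrite mxE.
by rewrite mxE; under eq_bigr do rewrite mxE.
Qed.

Definition supp (u : 'rV[F]_k) : {set 'I_k} := [set i | u 0 i != 0].

(** The elementary vectors of the left kernel of [B]: their support determines
    them up to scaling, which is what allows counting them by supports. *)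
Definition elementary (u : 'rV[F]_k) := forall v : 'rV[F]_k,
  v *m B = 0 -> supp v \subset supp u -> exists a, v = a *: u.

(** A second kernel vector [v] in the support of [u] can be corrected by a multiple
    of [u] to be orthogonal to [w].  Moving [u] along it then keeps the value on
    [w] negative, up to the moment when some entry of [u] vanishes. *)
Lemma shrink_certificate u v : certificate u -> v *m B = 0 ->
  supp v \subset supp u -> ~ (exists a, v = a *: u) ->
  exists2 u', certificate u' & supp u' \proper supp u.
Proof.
move=> [u0 uB uw] vB /fintype.subsetP sub vu.
have entryB n (c : F) (X Y : 'rV_n) i : (X - c *: Y) 0 i = X 0 i - c * Y 0 i.
  by rewrite !mxE.
pose v1 := v - ((v *m w) 0 0 / (u *m w) 0 0) *: u.
have v1w : (v1 *m w) 0 0 = 0.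
  by rewrite mulmxBl -scalemxAl entryB divfK ?subrr// ltr0_neq0.
have v1B : v1 *m B = 0 by rewrite mulmxBl -scalemxAl vB uB scaler0 subrr.
have v1sub i : u 0 i = 0 -> v1 0 i = 0.
  move=> ui; rewrite entryB ui mulr0 subr0; apply/eqP; apply: contraT => vi.
  by have := sub i; rewrite !inE ui eqxx => /(_ vi).
have [p v1p] : exists p, v1 0 p != 0.
  apply: contra_notP vu => v10; exists ((v *m w) 0 0 / (u *m w) 0 0).
  apply/eqP; rewrite -subr_eq0; apply/eqP/rowP => i.
  by rewrite [RHS]mxE; apply/eqP/negPn/negP => h; apply: v10; exists i.
have [v2 [v2w v2B v2sub v2p]] : exists v2 : 'rV[F]_k,
    [/\ (v2 *m w) 0 0 = 0, v2 *m B = 0, forall i, u 0 i = 0 -> v2 0 i = 0 &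
        0 < v2 0 p].
  have [v1p0|v1p0] := ltP 0 (v1 0 p); first by exists v1.
  exists (- v1); split; rewrite ?mulNmx ?v1B ?oppr0//.
  - by rewrite mxE v1w oppr0.
  - by move=> i ui; rewrite mxE v1sub ?oppr0.
  - by rewrite mxE oppr_gt0 lt_neqAle v1p.
(* [q] is the first entry to vanish when [u] moves along [- v2]. *)
case: (@arg_minP _ _ _ p (fun i => 0 < v2 0 i) (fun i => u 0 i / v2 0 i) v2p)
  => q v2q qmin.
pose t := u 0 q / v2 0 q.
have t0 : 0 <= t by rewrite divr_ge0// ltW.
exists (u - t *: v2); first split.
- move=> i; rewrite entryB subr_ge0; have [v2i|v2i] := ltP 0 (v2 0 i).
    by rewrite -ler_pdivlMr//; apply: qmin.
  by apply: (le_trans _ (u0 i)); rewrite mulr_ge0_le0.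
- by rewrite mulmxBl -scalemxAl uB v2B scaler0 subrr.
- by rewrite mulmxBl -scalemxAl entryB v2w mulr0 subr0.
rewrite properE; apply/andP; split.
  apply/fintype.subsetP => i; rewrite !inE entryB; apply: contra => /eqP ui.
  by rewrite ui v2sub// mulr0 subrr.
have uq : u 0 q != 0 by apply: contraTneq v2q => uq; rewrite v2sub ?ltxx.
apply/negP => /fintype.subsetP /(_ q); rewrite !inE entryB => /(_ uq).
by rewrite /t divfK ?(lt0r_neq0 v2q)// subrr eqxx.
Qed.

(** Shrinking the support of a certificate as long as possible ends with an
    elementary one, since any other can be shrunk further. *)
Lemma elementary_farkas :
  ~ (exists y : 'cV[F]_m, forall i, (B *m y) i 0 <= w i 0) ->
  exists2 u, certificate u & elementary u.
Proof.
move=> /farkas[u]; have [n] := ubnP #|supp u|.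
elim: n u => // n IHn u leun uC.
have [|/existsNP[v /not_implyP[vB /not_implyP[vu nv]]]] := pselect (elementary u).
  by exists u.
have [u' u'C /proper_card ltu] := shrink_certificate uC vB vu nv.
by apply: IHn u'C; apply: leq_trans ltu _.
Qed.

(** With [m + 2] rows in the support, the [m] kernel equations and one more
    equation forcing the entry at [i0] to vanish would still leave a nonzero
    solution, and it cannot be a multiple of [u]. *)
Lemma card_supp_elementary u : elementary u -> (#|supp u| <= m.+1)%N.
Proof.
move=> uE; rewrite leqNgt; apply/negP => lt_mS; pose S := supp u.
have [i0 i0S] : exists i0, i0 \in S.
  by apply/card_gt0P; apply: leq_ltn_trans lt_mS.
pose E : 'M[F]_(#|S|, k) := rowsub enum_val 1%:M.
pose C := E *m row_mx B (delta_mx i0 0 : 'cV_k).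
have : kermx C != 0.
  rewrite -mxrank_eq0 mxrank_ker subn_eq0 -ltnNge.
  by apply: leq_ltn_trans (rank_leq_col C) _; rewrite addn1.
case/rowV0Pn => x /sub_kermxP; rewrite mulmxA mul_mx_row -row_mx0.
move=> /eq_row_mx[xB xi0] x0; pose v := x *m E.
have vE i : v 0 i = \sum_j x 0 j * (enum_val j == i)%:R.
  by rewrite mxE; apply: eq_bigr => j _; rewrite !mxE.
have [|a va] := uE v xB.
  apply/fintype.subsetP => i; rewrite !inE vE; apply: contraNneq => ui.
  apply/eqP; apply: big1 => j _; case: eqP => [ji|]; last by rewrite mulr0.
  by have := enum_valP j; rewrite ji inE ui eqxx.
have : a * u 0 i0 = 0.
  have /matrixP/(_ 0 0) := xi0; rewrite -/v [LHS]mxE [RHS]mxE.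
  under eq_bigr do rewrite [delta_mx _ _ _ _]mxE andbT.
  rewrite (bigD1 i0)//= eqxx mulr1 big1 => [|i /negPf->]; last by rewrite mulr0.
  by rewrite addr0 va mxE.
move/eqP; rewrite mulf_eq0; move: (i0S); rewrite inE => /negPf->; rewrite orbF.
move=> /eqP a0; case/eqP: x0; apply/rowP => j.
have /rowP/(_ (enum_val j)) := va; rewrite vE a0 scale0r !mxE.
rewrite (bigD1 j)//= eqxx mulr1 big1 ?addr0// => j' /negPf jj'.
by rewrite (inj_eq enum_val_inj) jj' mulr0.
Qed.

End Certificates.

(** * Counting supports and sign vectors *)

Lemma card_small_sets (T : finType) n :
  (#|[set S : {set T} | (#|S| <= n)%N]%SET| <= #|T|.+1 ^ n)%N.
Proof.
pose set_of (g : {ffun 'I_n -> option T}) := [set x | Some x \in codom g]%SET.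
rewrite -card_option -[X in (_ ^ X)%N]card_ord -card_ffun -cardsT.
apply: leq_trans (leq_imset_card set_of _); apply: subset_leq_card.
apply/fintype.subsetP => S; rewrite inE => Sn; apply/imsetP.
exists [ffun i : 'I_n => onth (enum S) i]; rewrite ?inE//.
apply/setP => x; rewrite inE -mem_enum; apply/idP/codomP.
  move=> xS; have xn : (index x (enum S) < n)%N.
    by apply: leq_trans Sn; rewrite cardE index_mem.
  exists (Ordinal xn); rewrite ffunE /= onthE (nth_map x) ?index_mem//.
  by rewrite nth_index.
by case=> i; rewrite ffunE => /esym xi; apply/onthP; exists i.
Qed.

(** Inverting [1 - y <= exp (- y)] at [y = x - 2 x ^ 2] leaves
    [1 <= (1 + x) (1 - x + 2 x ^ 2) = 1 + x ^ 2 (1 + 2 x)] to check; with [x ^ 2]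
    in place of [2 x ^ 2] the product would be [1 + x ^ 3], too small for
    negative [x]. *)
Lemma expR_le1D (R : realType) (x : R) :
  - 2^-1 <= x -> expR (x - 2 * x ^+ 2) <= 1 + x.
Proof.
move=> xge; have D0 : 0 < 1 - x + 2 * x ^+ 2 by nra.
have : 1 - x + 2 * x ^+ 2 <= expR (- (x - 2 * x ^+ 2)).
  by apply: le_trans (expR_ge1Dx _); lra.
rewrite expRN => h.
have : expR (x - 2 * x ^+ 2) <= (1 - x + 2 * x ^+ 2)^-1.
  by rewrite -[leLHS]invrK lef_pV2 ?posrE ?invr_gt0 ?expR_gt0.
move=> /le_trans; apply; rewrite -[leLHS]mul1r ler_pdivrMr//.
have : 0 <= x ^+ 2 * (1 + 2 * x) by apply: mulr_ge0; [exact: sqr_ge0|lra].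
nra.
Qed.

Lemma sum_prod_signs (R : comNzRingType) d (x : 'I_d -> R) :
  \sum_(s : {ffun 'I_d -> bool}) \prod_i (1 + (-1) ^+ s i * x i) = 2 ^+ d.
Proof.
rewrite -(bigA_distr_bigA (fun i (e : bool) => 1 + (-1) ^+ e * x i)) /=.
rewrite (eq_bigr (fun=> 2)) ?prodr_const ?card_ord// => i _.
by rewrite big_bool /=; ring.
Qed.

(** Exponential Markov inequality with the products of the [1 + delta s_i v_i]
    instead of exponentials: these average to 1 over all sign vectors, and each is
    at least [exp (delta theta d - 2 delta ^ 2 d)] on the vectors counted here.
    The choice [delta = theta / 4] maximizes the exponent. *)
Lemma few_aligned_signs (R : realType) d (v : 'I_d -> R) (theta : R) :
  0 < theta <= 1 -> (forall i, `|v i| <= 1) ->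
  #|[set s : {ffun 'I_d -> bool} |
      theta * d%:R <= \sum_i (-1) ^+ s i * v i]%SET|%:R
    <= 2 ^+ d * expR (- (d%:R * theta ^+ 2 / 8)).
Proof.
move=> /andP[th0 th1] v1; set G := [set s | _]%SET.
rewrite expRN ler_pdivlMr ?expR_gt0//; pose delta := theta / 4.
rewrite -(sum_prod_signs (fun i => delta * v i)).
have absd s i : `|(-1) ^+ (s : bool) * (delta * v i)| <= delta.
  rewrite normrM normr_sign mul1r normrM (ger0_norm (_ : 0 <= delta)).
    by rewrite ler_piMr// /delta; lra.
  by rewrite /delta; lra.
have ge0 (s : {ffun 'I_d -> bool}) i : 0 <= 1 + (-1) ^+ s i * (delta * v i).
  by have := absd (s i) i; rewrite ler_norml /delta => /andP[]; lra.
rewrite (bigID (mem G)) /= -[leLHS]addr0 lerD//; last first.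
  by apply: sumr_ge0 => s _; apply: prodr_ge0.
rewrite -sumr_const mulr_suml; apply: ler_sum => s.
rewrite inE mul1r => sG.
apply: (@le_trans _ _ (\prod_i expR ((-1) ^+ s i * (delta * v i) - 2 * delta ^+ 2))).
  rewrite -expR_sum ler_expR sumrB sumr_const card_ord -mulr_natl.
  under eq_bigr do rewrite mulrCA.
  rewrite -mulr_sumr.
  have : delta * (theta * d%:R) <= delta * \sum_i (-1) ^+ s i * v i.
    by rewrite ler_wpM2l// /delta; lra.
  move: (delta * \sum_i _) => T; rewrite /delta; nra.
apply: ler_prod => i _; rewrite expR_ge0 /=.
have := absd (s i) i; set x := (-1) ^+ _ * _ => xd.
have x2 : x ^+ 2 <= delta ^+ 2.
  by rewrite -[x ^+ 2]real_normK ?num_real// lerXn2r// nnegrE// /delta; lra.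
apply: le_trans (expR_le1D _); last first.
  by move: xd; rewrite ler_norml /delta => /andP[]; lra.
by rewrite ler_expR; lra.
Qed.

(** * Inequalities needed by a projection *)

Definition sign_vector (R : pzRingType) d (s : {ffun 'I_d -> bool}) : 'cV[R]_d :=
  \col_i (-1) ^+ s i.

Section Projections.
Variables (R : realType) (d m k : nat) (A : 'M[R]_(k, d + m)) (b : 'cV[R]_k).
Let P := proj_x (polyhedron A b).

Lemma proj_polyhedronP x : P x <->
  exists y : 'cV_m, forall i, (rsubmx A *m y) i 0 <= (b - lsubmx A *m x) i 0.
Proof.
have AE (y : 'cV_m) i :
    (A *m col_mx x y) i 0 = (lsubmx A *m x) i 0 + (rsubmx A *m y) i 0.
  by rewrite -{1}(hsubmxK A) mul_row_col mxE.
have bE i : (b - lsubmx A *m x) i 0 = b i 0 - (lsubmx A *m x) i 0.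
  by rewrite mxE [X in _ + X]mxE.
by split=> -[y yP]; exists y => i; have := yP i; rewrite AE bE; lra.
Qed.

(** A nonnegative combination of the inequalities in which the additional
    variables cancel is an inequality for the projection. *)
Lemma certificate_valid (u : 'rV[R]_k) : (forall i, 0 <= u 0 i) -> u *m rsubmx A = 0 ->
  forall x, P x -> (u *m lsubmx A *m x) 0 0 <= (u *m b) 0 0.
Proof.
move=> u0 uB x /proj_polyhedronP[y yP].
have : (u *m (rsubmx A *m y)) 0 0 <= (u *m (b - lsubmx A *m x)) 0 0.
  rewrite [leLHS]mxE [leRHS]mxE; apply: ler_sum => i _.
  by rewrite ler_wpM2l.
by rewrite mulmxA uB mul0mx mulmxBr mulmxA [leLHS]mxE mxE [X in _ + X]mxE subr_ge0.
Qed.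

Hypothesis d_gt0 : (0 < d)%N.
Hypothesis P_delta : forall i, P (delta_mx i 0).
Hypothesis P_deltaN : forall i, P (- delta_mx i 0).

(** The inequality that the elementary multiplier [u] gives for the projection is
    violated by the point [(mu / d) s]. *)
Definition cuts_off (mu : R) (s : {ffun 'I_d -> bool}) (u : 'rV[R]_k) :=
  [/\ forall i, 0 <= u 0 i, u *m rsubmx A = 0, elementary (rsubmx A) u &
      (u *m b) 0 0 < mu / d%:R * \sum_i (-1) ^+ s i * (u *m lsubmx A) 0 i].

Lemma ex_cuts_off (mu : R) s : ~ P ((mu / d%:R) *: sign_vector R s) ->
  exists2 u, cuts_off mu s u & (#|supp u| <= m.+1)%N.
Proof.
rewrite proj_polyhedronP => /elementary_farkas[u [u0 uB uw] uE].
exists u; last exact: card_supp_elementary uE.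
split=> //; move: uw.
have entryB (c : R) (X Y : 'M[R]_1) : (X - c *: Y) 0 0 = X 0 0 - c * Y 0 0.
  by rewrite !mxE.
rewrite mulmxBr -scalemxAr -scalemxAr mulmxA entryB subr_lt0.
rewrite [(_ *m sign_vector _ _) _ _]mxE.
by under eq_bigr do rewrite [sign_vector _ _ _ _]mxE mulrC.
Qed.

(** The inequality holds at the unit vectors and their opposites, where its left
    side takes the entries of the normal vector and their opposites.  The right
    side is positive, as otherwise the normal vector would vanish and cut off
    nothing. *)
Lemma cuts_off_normal mu s u : cuts_off mu s u -> 0 < (u *m b) 0 0 /\
  forall i, `|(u *m lsubmx A) 0 i| <= (u *m b) 0 0.
Proof.
move=> [u0 uB _ us]; have valid := certificate_valid u0 uB.
have v_le i : `|(u *m lsubmx A) 0 i| <= (u *m b) 0 0.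
  have entry : ((u *m lsubmx A) *m (delta_mx i 0 : 'cV_d)) 0 0 = (u *m lsubmx A) 0 i.
    by rewrite -colE mxE.
  rewrite ler_norml lerNl; apply/andP; split.
    by have := valid _ (P_deltaN i); rewrite mulmxN mxE entry.
  by have := valid _ (P_delta i); rewrite entry.
split=> //; rewrite lt_neqAle (le_trans _ (v_le (Ordinal d_gt0)))// andbT.
apply: contraTneq us => /esym ub; rewrite ub big1 ?mulr0 ?ltxx// => i _.
by have := v_le i; rewrite ub normr_le0 => /eqP ->; rewrite mulr0.
Qed.

(** All elementary multipliers with a given support yield the same inequality up
    to a positive factor, so [few_aligned_signs] for one of them bounds the points
    cut off by any of them. *)
Lemma few_signs_per_support mu (S : {set 'I_k}) : 1 <= mu ->
  #|[set s | `[< exists2 u, cuts_off mu s u & supp u = S >] ]%SET|%:R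
    <= 2 ^+ d * expR (- (d%:R * mu^-1 ^+ 2 / 8)) :> R.
Proof.
move=> mu1; have mu0 : 0 < mu by lra.
set G := [set s | _]%SET.
have [->|/set0Pn[s0]] := eqVneq G finset.set0.
  by rewrite cards0 mulr_ge0 ?expR_ge0// exprn_ge0.
rewrite inE => /asboolP[u0 u0cut u0S].
have [b0 v0le] := cuts_off_normal u0cut.
set b0' := (_ *m b) 0 0 in b0 v0le; pose v i := (u0 *m lsubmx A) 0 i / b0'.
have v1 i : `|v i| <= 1.
  by rewrite normrM normfV (gtr0_norm b0) ler_pdivrMr// mul1r.
have mu01 : 0 < mu^-1 <= 1 by rewrite invr_gt0 mu0 invf_le1.
apply: le_trans (few_aligned_signs mu01 v1).
rewrite ler_nat; apply: subset_leq_card; apply/fintype.subsetP => s.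
rewrite [s \in G]inE => /asboolP[u ucut uS]; rewrite inE.
have [bu _] := cuts_off_normal ucut.
case: u0cut ucut => _ _ u0E _ [_ uB _]; have [|a ua] := u0E u uB.
  by rewrite uS u0S.
have scale (n : nat) (C : 'M[R]_(k, n)) i : (u *m C) 0 i = a * (u0 *m C) 0 i.
  by rewrite ua -scalemxAl mxE.
move: bu; rewrite !scale -/b0' pmulr_lgt0// => a0.
under eq_bigr do rewrite scale mulrCA.
rewrite -mulr_sumr mulrCA ltr_pM2l// => h.
under eq_bigr do rewrite /v mulrA.
rewrite -mulr_suml ler_pdivlMr//.
rewrite -mulrA ler_pdivrMl// mulrC -ler_pdivlMr ?ltr0n//.
by rewrite mulrAC ltW.
Qed.

(** Each of the [2 ^ d] points is cut off through one of the at most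
    [(k + 1) ^ (m + 1)] supports, and each support accounts for few of them. *)
Lemma many_inequalities mu : 1 <= mu ->
  (forall s, ~ P ((mu / d%:R) *: sign_vector R s)) ->
  expR (d%:R * mu^-1 ^+ 2 / 8) <= (k.+1 ^ m.+1)%:R.
Proof.
move=> mu1 out; pose small := [set S : {set 'I_k} | (#|S| <= m.+1)%N]%SET.
pose hit (S : {set 'I_k}) s := `[< exists2 u, cuts_off mu s u & supp u = S >].
have cover : (2 ^ d <= \sum_(S in small) #|[set s | hit S s]%SET|)%N.
  rewrite -card_bool -[X in (_ ^ X)%N](card_ord d) -card_ffun -sum1_card.
  under [leqRHS]eq_bigr do rewrite -sum1dep_card big_mkcond.
  rewrite exchange_big /=; apply: leq_sum => s _.
  have [u us uS] := ex_cuts_off (out s).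
  rewrite (bigD1 (supp u)) ?inE//= (_ : hit _ _)//.
  by apply/asboolP; exists u.
have : 2 ^+ d <= \sum_(S in small) 2 ^+ d * expR (- (d%:R * mu^-1 ^+ 2 / 8)) :> R.
  move: cover; rewrite -(ler_nat R) natrX natr_sum => /le_trans; apply.
  apply: ler_sum => S _; exact: few_signs_per_support.
rewrite sumr_const -mulrnAr ler_pMr ?exprn_gt0// expRN -mulr_natl.
rewrite ler_pdivlMr ?expR_gt0// mul1r => /le_trans; apply.
by rewrite ler_nat -[X in (X.+1 ^ _)%N]card_ord card_small_sets.
Qed.

End Projections.

(** * Polytopes and the two simplices *)

Lemma bounded_coordP (R : realType) n (X : set 'cV[R]_n) :
  bounded_set X <-> exists M, forall x, X x -> forall i, `|x i 0| <= M.
Proof.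
have normE (x : 'cV[R]_n) : `|x| = \big[Num.max/0]_p `|x p.1 p.2|.
  exact: mx_normrE.
split=> [[M [_ MX]]|[M MX]].
  exists (M + 1) => x Xx i; apply: le_trans (MX _ _ _ Xx); last by rewrite ltrDl.
  by rewrite normE; apply: (le_bigmax _ (fun p => `|x p.1 p.2|) (i, 0)).
exists (Num.max 0 M); split; first exact: num_real.
move=> N /ltW MN x Xx /=; rewrite normE; apply: bigmax_le.
  by apply: le_trans MN; rewrite le_max lexx.
by move=> [i j] _ /=; rewrite ord1; apply: le_trans (MX _ Xx i) (le_trans _ MN);
  rewrite le_max lexx orbT.
Qed.

(** The block of zero columns is there because [d + 0] does not compute to [d]. *)
Lemma formulation_self (R : realType) d k (A : 'M[R]_(k, d)) (b : 'cV[R]_k) :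
  bounded_set (polyhedron A b) ->
  formulation (polyhedron A b) (row_mx A (0 : 'M[R]_(k, 0))) b.
Proof.
have AE x (y : 'cV_0) : row_mx A 0 *m col_mx x y = A *m x.
  by rewrite mul_row_col mul0mx addr0.
move=> bP; split; first by split=> //; exists k, A, b.
  split; first by exists k, (row_mx A 0), b.
  have /bounded_coordP[M MP] := bP; apply/bounded_coordP; exists M => z.
  rewrite -[z]vsubmxK /polyhedron /= AE => /MP Mz i.
  by rewrite -[i]splitK; case: (fintype.split i) => [j|[]//]; rewrite col_mxEu.
apply/seteqP; split=> x.
  by exists 0 => i; rewrite AE.
by case=> y yP i; rewrite -(AE x y).
Qed.

(** For [e = 1] this system describes the convex hull of 0 and the unit vectors,
    for [e = -1] its opposite. *)
Definition simplex_mx (R : realType) d (e : R) : 'M[R]_(d + 1, d) :=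
  col_mx (- e)%:M (const_mx e).
Definition simplex_rhs (R : realType) d : 'cV[R]_(d + 1) := col_mx 0 1.

Definition simplex (R : realType) d (e : R) : set 'cV[R]_d :=
  polyhedron (simplex_mx d e) (simplex_rhs R d).

Lemma simplexP (R : realType) d (e : R) (x : 'cV_d) :
  simplex e x <-> (forall i, 0 <= e * x i 0) /\ \sum_i e * x i 0 <= 1.
Proof.
have sum_row : (const_mx e *m x : 'cV_1) 0 0 = \sum_i e * x i 0.
  by rewrite mxE; apply: eq_bigr => i _; rewrite mxE.
rewrite /simplex /polyhedron /simplex_mx /= mul_col_mx mul_scalar_mx; split.
  move=> xP; split=> [i|].
    by have := xP (lshift 1 i); rewrite !col_mxEu !mxE mulNr oppr_le0.
  by have := xP (rshift d 0); rewrite !col_mxEd sum_row mxE.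
move=> [x0 x1] i; rewrite -[i]splitK; case: (fintype.split i) => j /=.
  by rewrite !col_mxEu !mxE mulNr oppr_le0.
by rewrite !col_mxEd ord1 sum_row mxE.
Qed.

Lemma simplex_bounded (R : realType) d (e : R) : `|e| = 1 ->
  bounded_set (@simplex R d e).
Proof.
move=> e1; apply/bounded_coordP; exists 1 => x /simplexP[x0 x1] i.
have -> : `|x i 0| = e * x i 0 by rewrite -[RHS]ger0_norm// normrM e1 mul1r.
apply: le_trans x1.
by rewrite (bigD1 i)//= lerDl sumr_ge0.
Qed.

Lemma simplex_delta (R : realType) d (e : R) (i : 'I_d) : e * e = 1 ->
  simplex e (e *: delta_mx i 0).
Proof.
move=> ee; have entry j : e * (e *: delta_mx i 0 : 'cV_d) j 0 = (j == i)%:R.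
  by rewrite !mxE mulrA ee mul1r andbT.
apply/simplexP; split=> [j|]; first by rewrite entry.
by rewrite (bigD1 i)//= entry eqxx big1 ?addr0// => j /negPf ji; rewrite entry ji.
Qed.

Lemma simplex0 (R : realType) d (e : R) : @simplex R d e 0.
Proof.
by apply/simplexP; split=> [i|]; rewrite ?big1// => *; rewrite mxE mulr0.
Qed.

Lemma slab_convex (R : realType) d (c : 'rV[R]_d) (M : R) :
  convex_set [set x : 'cV[R]_d | `|(c *m x) 0 0| <= M].
Proof.
move=> x y t; rewrite !inE /= => xM yM.
have -> : (c *m (conv t (x : convex_lmodType 'cV[R]_d) y)) 0 0 =
    t%:num * (c *m x) 0 0 + (1 - t%:num) * (c *m y) 0 0.
  by rewrite mulmxDr -!scalemxAr [LHS]mxE [X in X + _]mxE [X in _ + X]mxE.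
have t0 : 0 <= t%:num by [].
have t1 : t%:num <= 1 by [].
apply: le_trans (ler_normD _ _) _; rewrite !normrM (ger0_norm t0).
rewrite (ger0_norm (_ : 0 <= 1 - _)) ?subr_ge0//.
have -> : M = t%:num * M + (1 - t%:num) * M by ring.
by rewrite lerD// ler_wpM2l// subr_ge0.
Qed.

Lemma simplex_union_slab (R : realType) d (s : {ffun 'I_d -> bool}) :
  conv_hull (simplex 1 `|` simplex (-1)) `<=`
    [set x : 'cV[R]_d | `|((sign_vector R s)^T *m x) 0 0| <= 1].
Proof.
apply: smallest_sub; first exact: slab_convex.
have slab (e : R) : `|e| = 1 -> simplex e `<=`
    [set x : 'cV[R]_d | `|((sign_vector R s)^T *m x) 0 0| <= 1].
  move=> e1 x /simplexP[x0 x1] /=; rewrite mxE.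
  apply: le_trans (ler_norm_sum _ _ _) (le_trans (ler_sum _ _) x1) => i _.
  by rewrite !mxE normrM normr_sign mul1r -[leLHS]mul1r -e1 -normrM ger0_norm.
by move=> x [|]; apply: slab; rewrite ?normrN normr1.
Qed.

(** In the direction [s] the hull has width at most 2, whereas an approximation
    that contains 0 and the point [(3 + 2 eps) / d s] has width at least
    [3 + 2 eps], more than [2 (1 + eps)]. *)
Lemma approximation_avoids (R : realType) d (eps : R) (P' : set 'cV[R]_d)
    (s : {ffun 'I_d -> bool}) : 0 < eps -> (0 < d)%N ->
  eps_approximation eps P' (conv_hull (simplex 1 `|` simplex (-1))) ->
  ~ P' (((3 + 2 * eps) / d%:R) *: sign_vector R s).
Proof.
move=> eps0 d0 [[_ /bounded_coordP[M MP']] PP' /(_ (sign_vector R s)^T)].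
set P := conv_hull _ in PP' *; set c := _^T => wid P's.
have P0 : P 0 by apply: sub_gen_smallest; left; apply: simplex0.
have P'0 := PP' _ P0.
have cs : (c *m (((3 + 2 * eps) / d%:R) *: sign_vector R s)) 0 0 = 3 + 2 * eps.
  rewrite -scalemxAr mxE [X in _ * X]mxE (eq_bigr (fun=> 1)).
    by rewrite sumr_const card_ord divfK// pnatr_eq0 -lt0n.
  by move=> i _; rewrite !mxE -expr2 sqrr_sign.
have c0 : (c *m (0 : 'cV_d)) 0 0 = 0 by rewrite mulmx0 mxE.
have cP' x : P' x -> `|(c *m x) 0 0| <= M *+ d.
  move=> P'x; rewrite mxE; apply: le_trans (ler_norm_sum _ _ _) _.
  rewrite -[X in _ *+ X]card_ord -sumr_const; apply: ler_sum => i _.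
  by rewrite !mxE normrM normr_sign mul1r; apply: MP'.
have : width c P <= 2.
  have cP x : P x -> -1 <= (c *m x) 0 0 <= 1.
    by rewrite -ler_norml; apply: simplex_union_slab.
  rewrite /width [leRHS](_ : 2 = 1 - -1); last by rewrite opprK.
  apply: lerB; [apply: ge_sup|apply: lb_le_inf].
  - by exists ((c *m (0 : 'cV_d)) 0 0), 0.
  - by move=> _ [x /cP/andP[_ ?] <-].
  - by exists ((c *m (0 : 'cV_d)) 0 0), 0.
  - by move=> _ [x /cP/andP[? _] <-].
have : 3 + 2 * eps <= width c P'.
  rewrite -[leLHS]subr0 lerB//.
    rewrite -cs; apply: ub_le_sup; last first.
      by exists (((3 + 2 * eps) / d%:R) *: sign_vector R s).
    by exists (M *+ d) => _ [x /cP' + <-]; rewrite ler_norml => /andP[].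
  rewrite -[leRHS]c0; apply: ge_inf; last by exists 0.
  by exists (- (M *+ d)) => _ [x /cP' + <-]; rewrite ler_norml => /andP[].
nra.
Qed.

(** * Growth estimates and the theorem *)

Lemma horner_le_monomial (R : realType) (p : {poly R}) :
  exists C D : nat, forall x : R, 1 <= x -> p.[x] <= C%:R * x ^+ D.
Proof.
pose S := \sum_(i < size p) `|p`_i|.
have S0 : 0 <= S by apply: sumr_ge0.
exists (Num.bound S), (size p) => x x1.
have xn n : 0 <= x ^+ n by apply: exprn_ge0; lra.
apply: (@le_trans _ _ (S * x ^+ size p)); last first.
  by rewrite ler_wpM2r// ltW// archi_boundP.
rewrite horner_coef mulr_suml; apply: ler_sum => i _.
apply: le_trans (ler_norm _) _; rewrite normrM (ger0_norm (xn _)).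
by rewrite ler_wpM2l// ler_weXn2l// ltnW.
Qed.

(** The bound is a power of [d] with no constant factor, which keeps the final
    logarithm a plain multiple of [ln d]; for [d >= 2] constants are absorbed by
    [C < 2 ^ C <= d ^ C], and [2 d + 2 <= d ^ 3]. *)
Lemma polynomial_size (R : realType) (sigma : {poly R}) :
  exists2 K : nat, (0 < K)%N & forall d k : nat, (2 <= d)%N ->
    k%:R <= sigma.[(d + 1 + (d + 1))%:R] -> (k.+1 <= d ^ K)%N.
Proof.
have [C [D CD]] := horner_le_monomial sigma.
exists (C.+1 + 3 * D)%N => // d k d2.
have x1 : 1 <= (d + 1 + (d + 1))%:R :> R by rewrite ler1n addn1.
move=> /le_trans/(_ (CD _ x1)); rewrite -natrX -natrM ler_nat => kle.
have x_le : (d + 1 + (d + 1) <= d ^ 3)%N.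
  by apply: (@leq_trans (d * 4)); [lia|rewrite leq_mul2l (@leq_exp2r 2 d 2) ?d2 ?orbT].
have d0 : (0 < d)%N by apply: ltnW.
rewrite expnD expnM; apply: (@leq_trans (C.+1 * (d ^ 3) ^ D)).
  rewrite mulSn; apply: (@leq_add 1 k); first by rewrite !expn_gt0 d0.
  apply: leq_trans kle _; rewrite leq_mul2l; apply/orP; right.
  by case: (D) => // n; rewrite leq_exp2r.
rewrite leq_mul2r; apply/orP; right.
by apply: (@leq_trans (2 ^ C.+1)); [exact/ltnW/ltn_expl|rewrite leq_exp2r].
Qed.

(** From [exp (c d) = exp (c d / 2) ^ 2 >= (c d / 2) ^ 2], which is at least [d] as
    soon as [d >= 4 / c ^ 2]. *)
Lemma ln_le_linear (R : realType) (c : R) : 0 < c ->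
  exists2 d0 : nat, (2 <= d0)%N & forall d, (d0 <= d)%N -> ln d%:R <= c * d%:R.
Proof.
move=> c0; have q0 : 0 < 4 / c ^+ 2 by rewrite divr_gt0// exprn_gt0.
exists (maxn 2 (Num.bound (4 / c ^+ 2))); first exact: leq_maxl.
move=> d; rewrite geq_max => /andP[d2 dc].
have d_gt0 : 0 < d%:R :> R by rewrite ltr0n ltnW.
rewrite -ler_expR lnK ?posrE//.
have -> : c * d%:R = c * d%:R / 2 + c * d%:R / 2 by field.
rewrite expRD.
have h : c * d%:R / 2 <= expR (c * d%:R / 2).
  by apply: le_trans (expR_ge1Dx _); lra.
have cd0 : 0 <= c * d%:R / 2 by rewrite !mulr_ge0 ?ltW.
apply: le_trans (ler_pM cd0 cd0 h h).
have : 4 / c ^+ 2 <= d%:R.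
  by apply: le_trans (_ : (Num.bound (4 / c ^+ 2))%:R <= _);
    [rewrite ltW// archi_boundP// ltW|rewrite ler_nat].
rewrite ler_pdivrMr ?exprn_gt0// => h4.
have := ler_wpM2r (ltW d_gt0) h4; nra.
Qed.

Theorem theorem3 (R : realType) (eps : R) (heps : 0 < eps)
    (sigma : {poly R}) :
  exists (c : R) (d0 : nat), 0 < c /\ (2 <= d0)%N /\
  forall d : nat,
  exists (P1 P2 : set 'cV[R]_d) (f1 m1 f2 m2 : nat)
    (A1 : 'M[R]_(f1, d + m1)) (b1 : 'cV[R]_f1)
    (A2 : 'M[R]_(f2, d + m2)) (b2 : 'cV[R]_f2),
    P1 !=set0 /\ P2 !=set0 /\
    formulation P1 A1 b1 /\ formulation P2 A2 b2 /\
    forall P' : set 'cV[R]_d,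
      eps_approximation eps P' (conv_hull (P1 `|` P2)) ->
    forall (k m : nat) (A : 'M[R]_(k, d + m)) (b : 'cV[R]_k),
      formulation P' A b ->
      k%:R <= sigma.[(f1 + f2)%:R] ->
      (d0 <= d)%N ->
      c * d%:R / ln d%:R <= m%:R.
Proof.
have [K K0 sizeK] := polynomial_size sigma.
pose mu := 3 + 2 * eps; pose eta := mu^-1 ^+ 2 / 8.
have mu1 : 1 <= mu by rewrite /mu; lra.
have eta0 : 0 < eta.
  by rewrite divr_gt0// exprn_gt0// invr_gt0; lra.
(* The logarithm of [many_inequalities] gives [m + 1 >= 2 c d / ln d]; the factor
   2 pays for the 1, as [c d / ln d >= 1] for large [d]. *)
pose c := eta / (2 * K%:R).
have KR0 : 0 < K%:R :> R by rewrite ltr0n.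
have c0 : 0 < c by rewrite divr_gt0// mulr_gt0.
have [d0 d0ge2 lnd] := ln_le_linear c0.
exists c, d0; split=> //; split=> // d.
exists (simplex 1), (simplex (-1)), (d + 1)%N, 0%N, (d + 1)%N, 0%N.
exists (row_mx (simplex_mx d 1) 0), (simplex_rhs R d).
exists (row_mx (simplex_mx d (-1)) 0), (simplex_rhs R d).
split; first by exists 0; apply: simplex0.
split; first by exists 0; apply: simplex0.
split; first by apply/formulation_self/simplex_bounded; rewrite normr1.
split; first by apply/formulation_self/simplex_bounded; rewrite normrN normr1.
move=> P' P'approx k m A b [_ _ P'E] ksize d0d.
have d2 : (2 <= d)%N by apply: leq_trans d0d.
have dgt0 : (0 < d)%N by apply: ltnW.
have hull_sub : simplex 1 `|` simplex (-1) `<=` proj_x (polyhedron A b).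
  rewrite -P'E; case: P'approx => _ + _; apply: subset_trans.
  exact: sub_gen_smallest.
have : expR (d%:R * eta) <= (k.+1 ^ m.+1)%:R.
  rewrite /eta mulrA; apply: many_inequalities mu1 _ => // [i|i|s].
  - by apply: hull_sub; left; have := simplex_delta i (mulr1 (1 : R)); rewrite scale1r.
  - apply: hull_sub; right; have := @simplex_delta R d (-1) i.
    by rewrite scaleN1r mulrNN mulr1; apply.
  - by rewrite -P'E; apply: approximation_avoids.
have dR1 : 1 < d%:R :> R by rewrite ltr1n.
have lnd0 : 0 < ln (d%:R : R) by rewrite ln_gt0.
have kd : (k.+1 ^ m.+1)%:R <= d%:R ^+ (K * m.+1) :> R.
  by rewrite -natrX ler_nat expnM leq_exp2r// sizeK.
move=> /le_trans => /(_ _ kd).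
rewrite -ler_ln ?posrE ?expR_gt0 ?exprn_gt0 ?(lt_trans ltr01)//.
rewrite expRK lnXn ?(lt_trans ltr01)//.
rewrite -[ln _ *+ _]mulr_natr natrM -[m.+1]addn1 natrD.
have := lnd d d0d; rewrite ler_pdivrMr//.
have -> : eta = 2 * K%:R * c by rewrite /c; field; rewrite gt_eqF.
move: (ln _) lnd0 => L L0 Ld h.
suff : K%:R * (2 * (c * d%:R)) <= K%:R * (L * (m%:R + 1)).
  by rewrite ler_pM2l//; lra.
by apply: le_trans (le_trans _ h) _; rewrite le_eqVlt; apply/orP; left; apply/eqP; ring.
Qed.
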